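(* Let $n_1,n_2,n_3,m\in\mathbb{N}_0$, let $U\subseteq\mathbb{R}^{n_1+n_2}$ be open and non-empty, let $H\in\mathcal{C}^\infty(U)$, and let $J,R\in\mathbb{R}^{(n_1+n_2+n_3+m)\times(n_1+n_2+n_3+m)}$ satisfy $J+J^\top=0$, $R=R^\top$, $R\geq 0$. Then the system $$\begin{pmatrix}\partial_{z_1}H(z_1,z_2)\\ \tfrac{\mathrm{d}}{\mathrm{d}t}z_2\\ 0\\ -y\end{pmatrix}=(J-R)\begin{pmatrix}\tfrac{\mathrm{d}}{\mathrm{d}t}z_1\\ \partial_{z_2}H(z_1,z_2)\\ z_3\\ u\end{pmatrix}$$ in the variables $(z_1,z_2,z_3,u,y)$, with $(z_1,z_2)$ taking values in $U$, may be represented as (that is, is equivalent to) (i) a port-Hamiltonian system with explicitly defined energy, and (ii) a port-Hamiltonian system with implicitly defined energy.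
   Context: All vector spaces are real and finite-dimensional; trajectories are smooth functions on an open interval $(t_0,t_1)$. Here $z_i$ takes values in $\mathbb{R}^{n_i}$ and $u,y$ take values in $\mathbb{R}^m$; $\mathbb{R}^k$ and its dual are identified via coordinates. Dirac structure: a subspace $D\leq X\oplus X^*$ which is isotropic and co-isotropic (i.e. $D=D^\perp$) with respect to $\langle\!\langle (f,e),(f',e')\rangle\!\rangle:=\langle e,f'\rangle+\langle e',f\rangle$. Lagrangian subspace: a subspace $L\leq X\oplus X^*$ which is isotropic and co-isotropic with respect to $\Omega_{\mathrm{can}}((f,e),(f',e')):=\langle e,f'\rangle-\langle e',f\rangle$. It is non-negative if $\langle e,f\rangle\ge 0$ for all $(f,e)\in L$. Lagrangian submanifold in an open set $U'\subseteq X$: a smooth submanifold $\mathcal{L}\subseteq U'\times X^*$ each of whose tangent spaces is a Lagrangian subspace of $X\oplus X^*$. Port-Hamiltonian system: given spaces $X,X_r,X_p$, an open set $U'\subseteq X$, a Dirac structure $\mathcal{D}\leq(X\oplus X_r\oplus X_p)\oplus(X^*\oplus X_r^*\oplus X_p^* )$, a non-negative Lagrangian subspace $L_r\leq X_r\oplus X_r^*$ and a Lagrangian submanifold $\mathcal{L}\subseteq U'\times X^*$, it is the system $$\big(\tfrac{\mathrm{d}}{\mathrm{d}t}x,f_r,-y,e,e_r,u\big)\in\mathcal{D},\qquad (f_r,e_r)\in L_r,\qquad (x,e)\in\mathcal{L}$$ with state $x$ (in $U'$), covector $e$, resistive port variables $(f_r,e_r)$ and external port variables $(u,y)$. Its energy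 is explicitly defined if $\mathcal{L}=\{(x,\partial_x K(x)) : x\in U'\}$ for a smooth function $K$ on $U'$; otherwise its energy is implicitly defined. Equivalence: a system is equivalent to a port-Hamiltonian system if its $u,y$ are the external port variables, its state variables $z_1,z_2$ are components of the state $x$, any further variables of the system (here $z_3$) are components of $e,f_r,e_r$ of the port-Hamiltonian system, and a trajectory solves the given system if and only if it can be completed by suitable remaining (latent) variables to a solution of the port-Hamiltonian system. *)

(* Defs.v *)
From HB Require Import structures.
From mathcomp Require Import all_boot all_order all_algebra.
From mathcomp Require Import all_classical all_reals all_analysis.

Set Implicit Arguments.
Unset Strict Implicit.
Unset Printing Implicit Defensive.

Import Order.TTheory GRing.Theory Num.Theory.
Import numFieldNormedType.Exports.

Local Open Scope classical_set_scope.
Local Open Scope ring_scope.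

(* A vector space X of dimension k and its dual are both 'cV[R]_k, and the
   duality pairing is the dot product.  X (+) X^* is the product type, with the
   flow f first and the effort e second. *)
Definition pairing (R : realType) (k : nat) (e f : 'cV[R]_k) : R :=
  (e^T *m f) 0 0.

Definition sym_form (R : realType) (k : nat) (p q : 'cV[R]_k * 'cV[R]_k) : R :=
  pairing p.2 q.1 + pairing q.2 p.1.

Definition can_form (R : realType) (k : nat) (p q : 'cV[R]_k * 'cV[R]_k) : R :=
  pairing p.2 q.1 - pairing q.2 p.1.

Definition orthogonal_space (R : realType) (V : vectType R) (b : V -> V -> R)
    (D : {vspace V}) : set V :=
  [set p | forall q, q \in D -> b p q = 0].

Definition isotropic (R : realType) (V : vectType R) (b : V -> V -> R)
    (D : {vspace V}) : Prop :=
  [set` D] `<=` orthogonal_space b D.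

Definition coisotropic (R : realType) (V : vectType R) (b : V -> V -> R)
    (D : {vspace V}) : Prop :=
  orthogonal_space b D `<=` [set` D].

Definition dirac_structure (R : realType) (k : nat)
    (D : {vspace ('cV[R]_k * 'cV[R]_k)}) : Prop :=
  isotropic (@sym_form R k) D /\ coisotropic (@sym_form R k) D.

Definition lagrangian_subspace (R : realType) (k : nat)
    (L : {vspace ('cV[R]_k * 'cV[R]_k)}) : Prop :=
  isotropic (@can_form R k) L /\ coisotropic (@can_form R k) L.

Definition nonneg_subspace (R : realType) (k : nat)
    (L : {vspace ('cV[R]_k * 'cV[R]_k)}) : Prop :=
  forall p, p \in L -> 0 <= pairing p.2 p.1.

(* C^k on an open set A of a finite-dimensional space: in finite dimension,
   x |-> 'd f x is C^k if and only if x |-> 'd f x v is C^k for each v.  The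
   values of f outside A are irrelevant. *)
Fixpoint Ck_on (R : realType) (V W : normedModType R) (k : nat) (A : set V)
    (f : V -> W) : Prop :=
  if k is k'.+1 then
    (forall x, A x -> differentiable f x) /\
    (forall v : V, Ck_on k' A (fun x => 'd f x v))
  else forall x, A x -> {for x, continuous f}.

Definition smooth_on (R : realType) (V W : normedModType R) (A : set V)
    (f : V -> W) : Prop :=
  forall k : nat, Ck_on k A f.

Definition gradient (R : realType) (k : nat) (K : 'cV[R]_k -> R)
    (x : 'cV[R]_k) : 'cV[R]_k :=
  \col_i 'D_(delta_mx i 0) K x.

(* Embedded submanifold, through slice charts: near each of its points M is
   carried by a diffeomorphism Psi (with inverse Phi) to the slice
   R^d x {0} of R^d x R^c. *)
Definition smooth_submanifold (R : realType) (V : normedModType R) (M : set V)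
    : Prop :=
  forall p, M p ->
    exists (d c : nat) (W : set V) (Psi : V -> 'cV[R]_d * 'cV[R]_c)
           (Phi : 'cV[R]_d * 'cV[R]_c -> V),
      [/\ open W /\ W p,
          open (Psi @` W),
          smooth_on W Psi /\ smooth_on (Psi @` W) Phi,
          forall x, W x -> Phi (Psi x) = x
        & forall x, W x -> (M x <-> (Psi x).2 = 0)].

(* Velocities at p of the smooth curves contained in M. *)
Definition tangent_space (R : realType) (V : normedModType R) (M : set V)
    (p : V) : set V :=
  [set v | exists (eps : R) (c : R -> V),
     [/\ 0 < eps, smooth_on `]- eps, eps[%classic c,
         forall t, - eps < t < eps -> M (c t),
         c 0 = p & derive1 c 0 = v]].

Definition lagrangian_submanifold (R : realType) (k : nat) (U : set 'cV[R]_k)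
    (L : set ('cV[R]_k * 'cV[R]_k)) : Prop :=
  [/\ forall p, L p -> U p.1,
      smooth_submanifold L
    & forall p, L p -> exists T : {vspace ('cV[R]_k * 'cV[R]_k)},
        tangent_space L p = [set` T] /\ lagrangian_subspace T].

(* X = R^k, X_r = R^r, X_p = R^m. *)
Record port_hamiltonian (R : realType) (k r m : nat) := PortHamiltonian {
  ph_domain : set 'cV[R]_k;
  ph_dirac : {vspace ('cV[R]_(k + r + m) * 'cV[R]_(k + r + m))};
  ph_resistive : {vspace ('cV[R]_r * 'cV[R]_r)};
  ph_energy : set ('cV[R]_k * 'cV[R]_k);
  ph_domain_open : open ph_domain;
  ph_diracP : dirac_structure ph_dirac;
  ph_resistiveP : lagrangian_subspace ph_resistive;
  ph_resistive_ge0 : nonneg_subspace ph_resistive;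
  ph_energyP : lagrangian_submanifold ph_domain ph_energy
}.

Definition explicit_energy (R : realType) (k r m : nat)
    (S : port_hamiltonian R k r m) : Prop :=
  exists K : 'cV[R]_k -> R,
    smooth_on (ph_domain S) K /\
    ph_energy S = [set p | ph_domain S p.1 /\ p.2 = gradient K p.1].

Definition implicit_energy (R : realType) (k r m : nat)
    (S : port_hamiltonian R k r m) : Prop :=
  ~ explicit_energy S.

Definition time_interval (R : realType) (t0 t1 : \bar R) : set R :=
  [set t | (t0 < t%:E)%E /\ (t%:E < t1)%E].

Definition ph_solution (R : realType) (k r m : nat)
    (S : port_hamiltonian R k r m) (I : set R)
    (x e : R -> 'cV[R]_k) (fr er : R -> 'cV[R]_r) (u y : R -> 'cV[R]_m)
    : Prop :=
  [/\ smooth_on I x /\ smooth_on I e,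
      smooth_on I fr /\ smooth_on I er,
      smooth_on I u /\ smooth_on I y
    & forall t, I t ->
      [/\ ph_domain S (x t),
          (col_mx (col_mx (derive1 x t) (fr t)) (- y t),
           col_mx (col_mx (e t) (er t)) (u t)) \in ph_dirac S,
          (fr t, er t) \in ph_resistive S
        & ph_energy S (x t, e t)]].

Definition system_solution (R : realType) (n1 n2 n3 m : nat)
    (U : set 'cV[R]_(n1 + n2)) (H : 'cV[R]_(n1 + n2) -> R)
    (J Rd : 'M[R]_(n1 + n2 + n3 + m)) (I : set R)
    (z1 : R -> 'cV[R]_n1) (z2 : R -> 'cV[R]_n2) (z3 : R -> 'cV[R]_n3)
    (u y : R -> 'cV[R]_m) : Prop :=
  [/\ [/\ smooth_on I z1, smooth_on I z2 & smooth_on I z3],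
      smooth_on I u /\ smooth_on I y
    & forall t, I t ->
      let z := col_mx (z1 t) (z2 t) in
      let dH1 := usubmx (gradient H z) in
      let dH2 := dsubmx (gradient H z) in
      U z /\
      col_mx (col_mx (col_mx dH1 (derive1 z2 t)) 0) (- y t) =
      (J - Rd) *m
        col_mx (col_mx (col_mx (derive1 z1 t) dH2) (z3 t)) (u t)].

(* The injections sigma and tau name the coordinates of x that are (z1, z2)
   and the coordinates of (e, f_r, e_r) that are z3. *)
Definition equivalent_to_ph (R : realType) (n1 n2 n3 m k r : nat)
    (sol : set R -> (R -> 'cV[R]_n1) -> (R -> 'cV[R]_n2) -> (R -> 'cV[R]_n3) ->
           (R -> 'cV[R]_m) -> (R -> 'cV[R]_m) -> Prop)
    (S : port_hamiltonian R k r m) : Prop :=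
  exists (sigma : 'I_(n1 + n2) -> 'I_k) (tau : 'I_n3 -> 'I_(k + r + r)),
    [/\ injective sigma, injective tau &
      forall (t0 t1 : \bar R), (t0 < t1)%E ->
      let I := time_interval t0 t1 in
      forall z1 z2 z3 u y,
        sol I z1 z2 z3 u y <->
        exists (x e : R -> 'cV[R]_k) (fr er : R -> 'cV[R]_r),
          (forall t, I t ->
             col_mx (z1 t) (z2 t) = rowsub sigma (x t) /\
             z3 t = rowsub tau (col_mx (col_mx (e t) (fr t)) (er t))) /\
          ph_solution S I x e fr er u y].

(* Main.v *)
Require Import Defs.
From HB Require Import structures.
From mathcomp Require Import all_boot all_order all_algebra.
From mathcomp Require Import all_classical all_reals all_analysis.
From mathcomp Require Import ring lra.

Set Implicit Arguments.
Unset Strict Implicit.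
Unset Printing Implicit Defensive.

Import Order.TTheory GRing.Theory Num.Theory.
Import numFieldNormedType.Exports.

Local Open Scope classical_set_scope.
Local Open Scope ring_scope.

(** Collect the right-hand factor of the system into the input
      w = (z1', dH/dz2, z3, u)
    and its left-hand side into the output o = (dH/dz1, z2', 0, - y), so that
    the system reads o = (J - Rd) w.  Open a resistive port with flow w and
    effort Rd w: then o = J w - e_r, f_r = w, e_r = Rd f_r.

    The first two equations, together with the vanishing of the third block of
    o, cut out a Dirac structure.  Indeed o differs from (f1, f2) and w from
    (e1, e2) only by exchanging flow and effort in some coordinates, an
    operation that preserves the symmetric pairing, so the pairing of two
    solutions is <J w, w'> + <J w', w> = 0; and the free parameters are
    numerous enough to test any vector orthogonal to all solutions
    (dissipative_diracP).  The third equation is the graph of a symmetric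
    non-negative matrix, hence a non-negative Lagrangian subspace.  The
    variable z3 survives as a block of f_r, the only place where it still
    occurs once the third block of o has been set to zero.

    For the energy both cases are treated at once.  The state is x = (x', z)
    with z = (z1, z2) in U and s additional coordinates x', and the energy
    relation is
      x' = 0,  e' arbitrary,  e_z = grad H (z).
    The Dirac structure requires e' = 0, so that (x', e') = (0, 0) along
    solutions and the behaviour of z is not affected.  For s = 0 the relation is
    the graph of grad H, and the energy is H itself; for s = 1 its projection to
    the states misses every point with x' <> 0, whereas a gradient graph
    projects onto the whole domain, so the energy is implicit.

    The analytic content is that this relation is a Lagrangian submanifold
    (constrained_energy_lagrangian).  Subtracting grad H (z) from e_z
    straightens it to a linear subspace, which gives global slice charts; its
    tangent spaces are {f' = 0, e_z = Hess H (z) f_z}, and such a space is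
    Lagrangian because the Hessian is symmetric (diff2_sym, hessian_sym).
    Finally, completing a solution of the system requires t |-> grad H (z t) to
    be smooth, which is the chain rule for iterated differentials
    (Ck_on_comp). *)

(** * Calculus of iterated differentials *)

(** Differentials are local, so an identity that holds only on an open set may
    be differentiated there. *)
Lemma near_eq_diff (R : realType) (V W : normedModType R) (f g : V -> W) x :
  (\forall y \near x, f y = g y) -> differentiable f x ->
  differentiable g x /\ 'd g x = 'd f x :> (V -> W).
Proof.
move=> fg df.
have fgx : f x = g x := nbhs_singleton fg.
have dg : g \o shift x = cst (g x) + 'd f x +o_ 0 id.
  apply/eqaddoP => _/posnumP[e].
  have /eqaddoP/(_ _ (gt0 e)) := diff_locally df.
  have : \forall y \near 0, f (y + x) = g (y + x).
    by move: fg; rewrite (near_shift 0) subr0.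
  apply: filterS2 => y Ey /=; rewrite -fgx.
  by rewrite ![(_ \o _ - _) y]/(_ - _) /= Ey.
have E := diff_unique (diff_continuous df) dg.
split=> //; apply/diff_locallyP; rewrite E; split=> //.
exact: diff_continuous.
Qed.

Lemma diff_linear_comp (R : realType) (V W X : normedModType R)
    (L : {linear W -> X}) (f : V -> W) x :
  continuous L -> differentiable f x ->
  differentiable (fun y => L (f y)) x /\
  forall v, 'd (fun y => L (f y)) x v = L ('d f x v).
Proof.
move=> Lc df; have dL : differentiable L (f x) by exact: linear_differentiable.
split; first exact: differentiable_comp.
by move=> v; rewrite (diff_comp df dL) /= diff_lin.
Qed.

Section ContinuousDifferentiability.
Variables (R : realType) (V : normedModType R) (A : set V).
Hypothesis A_open : open A.

(** The inductions on k below rely on this: the product and chain rules describe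
    'd f x v by a formula valid only for x in A. *)
Lemma Ck_on_eq (W : normedModType R) k (f g : V -> W) :
  (forall x, A x -> f x = g x) -> Ck_on k A f -> Ck_on k A g.
Proof.
elim: k f g => [|k IH] f g fg /=.
  move=> fc x Ax; rewrite /prop_for /continuous_at -(fg x Ax).
  apply: cvg_trans (fc x Ax); apply: near_eq_cvg.
  near=> y; apply: fg; near: y; exact: open_nbhs_nbhs.
move=> [df cf].
have E x : A x -> differentiable g x /\ 'd g x = 'd f x :> (V -> W).
  move=> Ax; apply: near_eq_diff (df x Ax).
  near=> y; apply: fg; near: y; exact: open_nbhs_nbhs.
split=> [x /E[]//|v]; apply: IH (cf v) => x /E[_ ->] //.
Unshelve. all: by end_near. Qed.

Lemma Ck_on_leS (W : normedModType R) k (f : V -> W) :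
  Ck_on k.+1 A f -> Ck_on k A f.
Proof.
elim: k f => [|k IH] f [df cf]; first by
  move=> x /df; exact: differentiable_continuous.
by split=> // v; apply: IH.
Qed.

Lemma Ck_on_cst (W : normedModType R) k (a : W) : Ck_on k A (cst a).
Proof.
elim: k a => [|k IH] a /=; first by move=> x _; exact: cvg_cst.
split=> [x _|v]; first exact: differentiable_cst.
by apply: Ck_on_eq (IH 0) => x _; rewrite diff_cst.
Qed.

Lemma Ck_on_add (W : normedModType R) k (f g : V -> W) :
  Ck_on k A f -> Ck_on k A g -> Ck_on k A (fun x => f x + g x).
Proof.
elim: k f g => [|k IH] f g /=.
  by move=> cf cg x Ax; apply: continuousD; [exact: cf|exact: cg].
move=> [df cf] [dg cg]; split=> [x Ax|v].
  by apply: differentiableD; [exact: df|exact: dg].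
apply: Ck_on_eq (IH _ _ (cf v) (cg v)) => x Ax.
exact: esym (congr1 (fun h : V -> W => h v) (diffD (df x Ax) (dg x Ax))).
Qed.

Lemma Ck_on_sum (W : normedModType R) k n (f : 'I_n -> V -> W) :
  (forall i, Ck_on k A (f i)) -> Ck_on k A (fun x => \sum_i f i x).
Proof.
elim: n f => [|n IH] f cf.
  by apply: Ck_on_eq (Ck_on_cst k 0) => x _; rewrite big_ord0.
apply: (@Ck_on_eq _ _ (fun x => f ord0 x + \sum_i f (lift ord0 i) x)).
  by move=> x _; rewrite big_ord_recl.
by apply: Ck_on_add => //; apply: IH.
Qed.

Lemma Ck_on_linear (W X : normedModType R) k (L : {linear W -> X})
    (f : V -> W) :
  continuous L -> Ck_on k A f -> Ck_on k A (fun x => L (f x)).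
Proof.
move=> Lc; elim: k f => [|k IH] f /=.
  move=> cf x Ax; apply: (@continuous_comp _ _ _ f L x); first exact: cf.
  exact: Lc.
move=> [df cf]; split=> [x Ax|v].
  by have [] := diff_linear_comp Lc (df x Ax).
by apply: Ck_on_eq (IH _ (cf v)) => x Ax;
  have [_ ->] := diff_linear_comp Lc (df x Ax).
Qed.

Lemma Ck_on_pair (W X : normedModType R) k (f : V -> W) (g : V -> X) :
  Ck_on k A f -> Ck_on k A g -> Ck_on k A (fun x => (f x, g x)).
Proof.
elim: k f g => [|k IH] f g /=.
  by move=> cf cg x Ax; apply: cvg_pair; [exact: cf|exact: cg].
move=> [df cf] [dg cg]; split=> [x Ax|v].
  by apply: differentiable_pair; [exact: df|exact: dg].
apply: Ck_on_eq (IH _ _ (cf v) (cg v)) => x Ax.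
by rewrite (diff_pair (df x Ax) (dg x Ax)).
Qed.

Lemma Ck_on_mul k (f g : V -> R) :
  Ck_on k A f -> Ck_on k A g -> Ck_on k A (fun x => f x * g x).
Proof.
elim: k f g => [|k IH] f g.
  by move=> cf cg x Ax; apply: continuousM; [exact: cf|exact: cg].
move=> Cf Cg; have [df cf] := Cf; have [dg cg] := Cg; split=> [x Ax|v].
  by apply: differentiableM; [exact: df|exact: dg].
apply: Ck_on_eq (Ck_on_add (IH _ _ (Ck_on_leS Cf) (cg v))
                           (IH _ _ (Ck_on_leS Cg) (cf v))).
move=> x Ax.
exact: esym (congr1 (fun h : V -> R => h v) (diffM (df x Ax) (dg x Ax))).
Qed.

End ContinuousDifferentiability.

Lemma linear_cV_continuous (R : realType) (W : normedModType R) n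
    (L : {linear 'cV[R]_n -> W}) : continuous L.
Proof.
have -> : (L : _ -> _) = fun v => \sum_i v i 0 *: L (delta_mx i 0).
  apply/funext => v; rewrite {1}[v]matrix_sum_delta linear_sum.
  by apply: eq_bigr => i _; rewrite big_ord1 linearZ.
apply: continuous_big => [|i _ v]; first exact: add_continuous.
apply: (@continuous_comp _ _ _ (fun M : 'cV[R]_n => M i 0)
  (fun a => a *: L (delta_mx i 0))).
  exact: coord_continuous.
exact: scalel_continuous.
Qed.

Lemma diff_coord_sum (R : realType) n (W : normedModType R)
    (g : 'cV[R]_n -> W) y v :
  'd g y v = \sum_i v i 0 *: 'd g y (delta_mx i 0).
Proof.
rewrite {1}[v]matrix_sum_delta linear_sum.
by apply: eq_bigr => i _; rewrite big_ord1 linearZ.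
Qed.

Lemma Ck_on_coord (R : realType) (V : normedModType R) (A : set V) k m n
    (f : V -> 'M[R]_(m, n)) i j :
  open A -> Ck_on k A f -> Ck_on k A (fun x => f x i j).
Proof.
move=> oA; pose c (M : 'M[R]_(m, n)) : R := M i j.
have c_lin : linear c by move=> a u v; rewrite /c !mxE.
pose cL : {linear 'M[R]_(m, n) -> R} :=
  HB.pack c (GRing.isLinear.Build _ _ _ _ _ c_lin).
apply: (@Ck_on_linear _ _ _ oA _ _ k cL); exact: coord_continuous.
Qed.

(** The outer map is scalar so that the product rule for scalars suffices: in
    coordinates, d(g o f) x v is the sum over i of the i-th coordinate of
    df x v times the i-th partial derivative of g at f x, and the induction
    hypothesis applies to these partial derivatives. *)
Lemma Ck_on_comp (R : realType) (V : normedModType R) (A : set V) n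
    (B : set 'cV[R]_n) k (f : V -> 'cV[R]_n) (g : 'cV[R]_n -> R) :
  open A -> (forall x, A x -> B (f x)) -> Ck_on k A f -> Ck_on k B g ->
  Ck_on k A (fun x => g (f x)).
Proof.
move=> oA AB; elim: k g => [|k IH] g.
  move=> cf cg x Ax; apply: (@continuous_comp _ _ _ f g x); first exact: cf.
  exact/cg/AB.
move=> Cf [dg cg]; have [df cf] := Cf; split=> [x Ax|v].
  by apply: (@differentiable_comp _ _ _ _ f g); [exact: df|exact/dg/AB].
apply: (@Ck_on_eq _ _ _ oA _ _
  (fun x => \sum_i 'd f x v i 0 * 'd g (f x) (delta_mx i 0))) => [x Ax|].
  by rewrite (diff_comp (df x Ax) (dg _ (AB _ Ax))) /= diff_coord_sum.
apply: Ck_on_sum => // i; apply: Ck_on_mul => //.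
  exact: Ck_on_coord (cf v).
by apply: IH (cg _); exact: Ck_on_leS.
Qed.

Lemma Ck_on_id (R : realType) (V : normedModType R) (A : set V) k :
  open A -> Ck_on k A id.
Proof.
move=> oA; case: k => [|k]; first by move=> x _; exact: cvg_id.
split=> // v; apply: Ck_on_eq (Ck_on_cst oA k v) => // x _.
by rewrite diff_val.
Qed.

Section SmoothMaps.
Variables (R : realType) (V : normedModType R) (A : set V).
Hypothesis A_open : open A.

Lemma Ck_on_scalel (W : normedModType R) k (f : V -> R) (a : W) :
  Ck_on k A f -> Ck_on k A (fun x => f x *: a).
Proof.
have a_lin : linear (fun t : R => t *: a).
  by move=> b u v; rewrite scalerDl scalerA.
pose aL : {linear R -> W} :=
  HB.pack (fun t : R => t *: a) (GRing.isLinear.Build _ _ _ _ _ a_lin).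
by apply: (Ck_on_linear A_open (L := aL)); exact: scalel_continuous.
Qed.

Lemma smooth_on_linear_cV (W : normedModType R) n (L : {linear 'cV[R]_n -> W})
    (f : V -> 'cV[R]_n) :
  smooth_on A f -> smooth_on A (fun x => L (f x)).
Proof.
move=> sf k; apply: Ck_on_linear (sf k) => //; exact: linear_cV_continuous.
Qed.

(** Writing a stacked vector as a sum of linear images reduces its smoothness
    and its differential to those of sums and of linear maps. *)
Lemma col_mx_sum n1 n2 (a : 'cV[R]_n1) (b : 'cV[R]_n2) :
  col_mx a b = col_mx 1%:M 0 *m a + col_mx 0 1%:M *m b.
Proof. by rewrite !mul_col_mx !mul1mx !mul0mx add_col_mx addr0 add0r. Qed.

Lemma smooth_on_col_mx n1 n2 (f : V -> 'cV[R]_n1) (g : V -> 'cV[R]_n2) :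
  smooth_on A f -> smooth_on A g -> smooth_on A (fun x => col_mx (f x) (g x)).
Proof.
move=> sf sg k; under eq_fun do rewrite col_mx_sum.
by apply: Ck_on_add => //; apply: smooth_on_linear_cV.
Qed.

Lemma smooth_on_diff (W : normedModType R) (f : V -> W) v :
  smooth_on A f -> smooth_on A (fun x => 'd f x v).
Proof. by move=> sf k; have [_] := sf k.+1; apply. Qed.

Lemma smooth_on_differentiable (W : normedModType R) (f : V -> W) x :
  smooth_on A f -> A x -> differentiable f x.
Proof. by move=> /(_ 1)[df _]; exact: df. Qed.

Lemma smooth_on_gradient_comp n (U : set 'cV[R]_n) (H : 'cV[R]_n -> R)
    (f : V -> 'cV[R]_n) :
  (forall x, A x -> U (f x)) -> smooth_on A f -> smooth_on U H ->
  smooth_on A (fun x => gradient H (f x)).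
Proof.
move=> AU sf sH k.
apply: (@Ck_on_eq _ _ _ A_open _ _
  (fun x => \sum_i 'd H (f x) (delta_mx i 0) *: delta_mx i 0)) => [x Ax|].
  rewrite [RHS]matrix_sum_delta; apply: eq_bigr => i _.
  rewrite big_ord1 mxE deriveE //.
  by have [dH _] := sH 1; exact/dH/AU.
apply: Ck_on_sum => // i; apply: Ck_on_scalel.
have [_ /(_ (delta_mx i 0)) dH] := sH k.+1.
exact: Ck_on_comp (sf k) dH.
Qed.

End SmoothMaps.

Lemma diff_linear_cV (R : realType) (V W : normedModType R) n
    (L : {linear 'cV[R]_n -> W}) (f : V -> 'cV[R]_n) x :
  differentiable f x ->
  differentiable (fun y => L (f y)) x /\
  forall v, 'd (fun y => L (f y)) x v = L ('d f x v).
Proof. apply: diff_linear_comp; exact: linear_cV_continuous. Qed.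

Lemma diff_col_mx (R : realType) (V : normedModType R) n1 n2
    (f : V -> 'cV[R]_n1) (g : V -> 'cV[R]_n2) x :
  differentiable f x -> differentiable g x ->
  differentiable (fun y => col_mx (f y) (g y)) x /\
  forall v, 'd (fun y => col_mx (f y) (g y)) x v = col_mx ('d f x v) ('d g x v).
Proof.
move=> df dg.
have [df1 df2] := diff_linear_cV (mulmx (col_mx 1%:M (0 : 'M[R]_(n2, n1)))) df.
have [dg1 dg2] := diff_linear_cV (mulmx (col_mx (0 : 'M[R]_(n1, n2)) 1%:M)) dg.
have -> : (fun y => col_mx (f y) (g y)) =
  (fun y => col_mx 1%:M 0 *m f y) + (fun y => col_mx 0 1%:M *m g y).
  by apply/funext => y; rewrite col_mx_sum.
split=> [|v]; first exact: differentiableD.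
have E := diffD df1 dg1.
rewrite [RHS]col_mx_sum -(df2 v) -(dg2 v).
exact: (congr1 (fun h : V -> _ => h v) E).
Qed.

Lemma diff_affine (R : realType) (V : normedModType R) (a b : V) (t : R) :
  differentiable (fun s : R => a + s *: b) t /\
  forall h, 'd (fun s : R => a + s *: b) t h = h *: b.
Proof.
have L : is_diff t (fun s : R => a + s *: b) (fun s => s *: b).
  have := is_diffD (is_diff_cst a t) (is_diff_scalel t b).
  by move=> /is_diff_eq; apply; apply/funext => s; rewrite /= add0r.
by split=> // h; rewrite diff_val.
Qed.

Lemma smooth_on_affine (R : realType) (V : normedModType R) (a b : V)
    (A : set R) :
  open A -> smooth_on A (fun s : R => a + s *: b).
Proof.
move=> oA k; apply: Ck_on_add => //; first exact: Ck_on_cst.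
by apply: Ck_on_scalel => //; exact: Ck_on_id.
Qed.

Lemma time_interval_open (R : realType) (t0 t1 : \bar R) :
  open (time_interval t0 t1).
Proof.
have lt0 : open [set t : R | (t0 < t%:E)%E].
  case: t0 => [a||].
  - by under eq_set do rewrite lte_fin; exact: open_gt.
  - rewrite (_ : [set _ | _] = set0); first exact: open0.
    by apply/seteqP; split=> t //=; rewrite ltNge leey.
  - rewrite (_ : [set _ | _] = setT); first exact: openT.
    by apply/seteqP; split=> t //= _; exact: ltNyr.
have lt1 : open [set t : R | (t%:E < t1)%E].
  case: t1 => [a||].
  - by under eq_set do rewrite lte_fin; exact: open_lt.
  - rewrite (_ : [set _ | _] = setT); first exact: openT.
    by apply/seteqP; split=> t //= _; exact: ltry.
  - rewrite (_ : [set _ | _] = set0); first exact: open0.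
    by apply/seteqP; split=> t //=; rewrite ltNge leNye.
exact: openI.
Qed.

Section Curves.
Variables (R : realType) (I : set R).
Hypothesis I_open : open I.

Lemma smooth_on_derive1 (V : normedModType R) (f : R -> V) :
  smooth_on I f -> smooth_on I (derive1 f).
Proof.
move=> sf k; apply: (@Ck_on_eq _ _ _ I_open _ _ (fun t => 'd f t 1)).
  by move=> t It; rewrite derive1E' //; exact: smooth_on_differentiable sf It.
exact: smooth_on_diff.
Qed.

Lemma smooth_on_eq (V : normedModType R) (f g : R -> V) :
  (forall t, I t -> f t = g t) -> smooth_on I f -> smooth_on I g.
Proof. by move=> fg sf k; apply: Ck_on_eq fg (sf k). Qed.

(** In this form the blocks of the velocity of x are the velocities of the
    blocks of x, even when the two curves are related on I only. *)
Lemma derive1_linear_cV n (V : normedModType R) (L : {linear 'cV[R]_n -> V})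
    (f : R -> 'cV[R]_n) (g : R -> V) t :
  (forall r, I r -> g r = L (f r)) -> smooth_on I f -> I t ->
  derive1 g t = L (derive1 f t).
Proof.
move=> gLf sf It; have df := smooth_on_differentiable sf It.
have [dLf ELf] := diff_linear_cV L df.
have near_g : \forall r \near t, L (f r) = g r.
  by near=> r; apply/esym/gLf; near: r; exact: open_nbhs_nbhs.
have [dg Eg] := near_eq_diff near_g dLf.
apply: etrans (derive1E' dg) _.
apply: etrans (congr1 (fun h : R -> V => h 1) Eg) _.
exact: etrans (ELf 1) (congr1 L (esym (derive1E' df))).
Unshelve. all: by end_near. Qed.

End Curves.

(** * The duality pairing *)

Section Pairing.
Variable R : realType.

Lemma pairingE k (e f : 'cV[R]_k) : pairing e f = \sum_i e i 0 * f i 0.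
Proof. by rewrite /pairing mxE; apply: eq_bigr => i _; rewrite mxE. Qed.

Lemma pairingC k (e f : 'cV[R]_k) : pairing e f = pairing f e.
Proof. by rewrite !pairingE; apply: eq_bigr => i _; rewrite mulrC. Qed.

Lemma pairingDl k (e e' f : 'cV[R]_k) :
  pairing (e + e') f = pairing e f + pairing e' f.
Proof. by rewrite /pairing linearD mulmxDl mxE. Qed.

Lemma pairingNl k (e f : 'cV[R]_k) : pairing (- e) f = - pairing e f.
Proof. by rewrite /pairing linearN mulNmx mxE. Qed.

Lemma pairing0l k (f : 'cV[R]_k) : pairing 0 f = 0.
Proof. by rewrite /pairing linear0 mul0mx mxE. Qed.

Lemma pairing0r k (e : 'cV[R]_k) : pairing e 0 = 0.
Proof. by rewrite pairingC pairing0l. Qed.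

Lemma pairing_mulmx k (M : 'M[R]_k) (e f : 'cV[R]_k) :
  pairing (M *m e) f = pairing (M^T *m f) e.
Proof. by rewrite pairingC /pairing trmx_mul trmxK mulmxA. Qed.

Lemma pairing_col_mx k l (e f : 'cV[R]_k) (e' f' : 'cV[R]_l) :
  pairing (col_mx e e') (col_mx f f') = pairing e f + pairing e' f'.
Proof. by rewrite /pairing tr_col_mx mul_row_col mxE. Qed.

Lemma pairing_nondeg k (e : 'cV[R]_k) : (forall f, pairing e f = 0) -> e = 0.
Proof.
move=> e0; apply/colP => i; have := e0 (delta_mx i 0).
rewrite pairingE (bigD1 i) //= big1 => [|j ji]; last first.
  by rewrite [delta_mx _ _ _ _]mxE (negbTE ji) mulr0.
by rewrite [delta_mx _ _ _ _]mxE !eqxx mulr1 addr0 => ->; rewrite mxE.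
Qed.

End Pairing.

(** * Symmetry of second derivatives *)

Lemma is_derive_line (R : realType) (V : normedModType R) (F : V -> R) q v
    (s : R) :
  differentiable F (q + s *: v) ->
  is_derive s 1 (fun t => F (q + t *: v)) ('d F (q + s *: v) v).
Proof.
move=> dF; have [dL EL] := diff_affine q v s.
have D := @differentiable_comp _ _ _ _ (fun t : R => q + t *: v) F s dL dF.
apply: DeriveDef; first exact: diff_derivable.
rewrite deriveE //.
apply: etrans (congr1 (fun h : R -> R => h 1) (diff_comp dL dF)) _.
exact: (congr1 ('d F (q + s *: v)) (etrans (EL 1) (scale1r _))).
Qed.

(** The mean value theorem is applied twice: to the increment of H in the
    direction w, as a function of the displacement along v, and then to the
    derivative of H along v, as a function of the displacement along w. *)
Lemma double_difference (R : realType) (V : normedModType R) (U : set V)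
    (H : V -> R) p v w (h : R) :
  Ck_on 2 U H -> 0 < h ->
  (forall s t, 0 <= s <= h -> 0 <= t <= h -> U (p + s *: v + t *: w)) ->
  exists s t : R, [/\ 0 <= s <= h, 0 <= t <= h &
    H (p + h *: v + h *: w) - H (p + h *: v) - (H (p + h *: w) - H p) =
    'd (fun x => 'd H x v) (p + s *: v + t *: w) w * h * h].
Proof.
move=> [dH ddH] h0 sqU.
have h0h : 0 <= h <= h by rewrite lexx ltW.
have z0h : 0 <= (0 : R) <= h by rewrite lexx ltW.
have Dg s : 0 <= s <= h ->
    is_derive s 1 (fun t => H (p + h *: w + t *: v) - H (p + t *: v))
      ('d H (p + h *: w + s *: v) v - 'd H (p + s *: v) v).
  move=> s0h; have D1 : is_derive s 1 (fun t => H (p + h *: w + t *: v))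
      ('d H (p + h *: w + s *: v) v).
    by apply: is_derive_line; apply: dH; rewrite addrAC; exact: sqU.
  have D2 : is_derive s 1 (fun t => H (p + t *: v)) ('d H (p + s *: v) v).
    apply: is_derive_line; apply: dH.
    by have := sqU s 0 s0h z0h; rewrite scale0r addr0.
  exact: (is_deriveB D1 D2).
have [||s sI] := MVT h0
    (df := fun s => 'd H (p + h *: w + s *: v) v - 'd H (p + s *: v) v)
    (f := fun t => H (p + h *: w + t *: v) - H (p + t *: v)).
- by move=> s; rewrite in_itv /= => /andP[/ltW a /ltW b]; apply: Dg; rewrite a.
- apply: derivable_within_continuous => s; rewrite in_itv /= => /Dg D.
  exact: ex_derive.
have s0h : 0 <= s <= h by move: sI; rewrite in_itv /= => /andP[/ltW-> /ltW->].
rewrite subr0 => Es.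
have Df t : 0 <= t <= h -> is_derive t 1 (fun t => 'd H (p + s *: v + t *: w) v)
      ('d (fun x => 'd H x v) (p + s *: v + t *: w) w).
  move=> t0h; apply: (is_derive_line (F := fun x => 'd H x v)).
  by have [d _] := ddH v; exact/d/sqU.
have [||t tI] := MVT h0
    (df := fun t => 'd (fun x => 'd H x v) (p + s *: v + t *: w) w)
    (f := fun t => 'd H (p + s *: v + t *: w) v).
- by move=> t; rewrite in_itv /= => /andP[/ltW a /ltW b]; apply: Df; rewrite a.
- apply: derivable_within_continuous => t; rewrite in_itv /= => /Df D.
  exact: ex_derive.
rewrite subr0 scale0r addr0 => Et; exists s, t; split=> //.
  by move: tI; rewrite in_itv /= => /andP[/ltW-> /ltW->].
by rewrite -Et [p + s *: v + _]addrAC -Es scale0r !addr0 [p + _ + h *: v]addrAC.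
Qed.

(** The second difference of H over a small parallelogram does not depend on
    the order of its sides, and by [double_difference] it is h^2 times either
    mixed derivative at a point close to p; continuity of the mixed derivatives
    concludes. *)
Lemma diff2_sym (R : realType) (V : normedModType R) (U : set V) (H : V -> R)
    p v w :
  open U -> Ck_on 2 U H -> U p ->
  'd (fun x => 'd H x v) p w = 'd (fun x => 'd H x w) p v.
Proof.
move=> oU CH Up; apply/eqP; rewrite -subr_eq0 -normr_le0.
apply/ler_addgt0Pr => e e0; rewrite add0r.
have e2 : 0 < e / 2 by rewrite divr_gt0.
pose N := [set q | [/\ U q,
  `|'d (fun x => 'd H x v) p w - 'd (fun x => 'd H x v) q w| < e / 2 &
  `|'d (fun x => 'd H x w) p v - 'd (fun x => 'd H x w) q v| < e / 2]].
have near_p a b : \forall q \near p,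
    `|'d (fun x => 'd H x a) p b - 'd (fun x => 'd H x a) q b| < e / 2.
  have [_ /(_ a)[_ /(_ b) c]] := CH.
  by have /cvgrPdist_lt/(_ _ e2) := c p Up.
have : nbhs p N.
  near=> q; split; near: q; [|exact: near_p|exact: near_p].
  exact: open_nbhs_nbhs.
move=> /nbhs_normP[d d0 dN].
(* h (|v| + |w|) < d keeps the whole parallelogram in N *)
pose h := d / (`|v| + `|w| + 1) / 2.
have D0 : 0 < `|v| + `|w| + 1 by rewrite ltr_wpDl // addr_ge0.
have h0 : 0 < h by rewrite !divr_gt0.
have hN s t : 0 <= s <= h -> 0 <= t <= h -> N (p + s *: v + t *: w).
  move=> /andP[s0 sh] /andP[t0 th]; apply: dN;
    rewrite /= -addrA opprD addrA subrr sub0r normrN.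
  apply: (@le_lt_trans _ _ (h * (`|v| + `|w| + 1))).
    apply: le_trans (ler_normD _ _) _;
      rewrite !normrZ !ger0_norm // mulrDr mulrDr mulr1.
    by rewrite ler_wpDr ?(ltW h0) // lerD // ler_wpM2r.
  by rewrite /h mulrAC divfK ?gt_eqF // ltr_pdivrMr // ltr_pMr // ltrDl.
have [s [t [s0 t0 E]]] := double_difference CH h0
  (fun s t s0 t0 => let: And3 Ux _ _ := hN s t s0 t0 in Ux).
have hN' s' t' : 0 <= s' <= h -> 0 <= t' <= h -> N (p + s' *: w + t' *: v).
  by move=> *; rewrite addrAC; exact: hN.
have [s' [t' [s'0 t'0 E']]] := double_difference CH h0
  (fun s t s0 t0 => let: And3 Ux _ _ := hN' s t s0 t0 in Ux).
have EE : 'd (fun x => 'd H x v) (p + s *: v + t *: w) w =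
    'd (fun x => 'd H x w) (p + s' *: w + t' *: v) v.
  have hu : h \is a GRing.unit by rewrite unitfE gt_eqF.
  apply: (mulIr hu); apply: (mulIr hu); rewrite -E -E' [p + h *: w + _]addrAC.
  by rewrite !opprB addrACA [RHS]addrACA; congr (_ + _); exact: addrC.
have [_ Nv _] := hN s t s0 t0; have [_ _ Nw] := hN' s' t' s'0 t'0.
apply: ltW; rewrite (splitr e); apply: le_lt_trans (ltrD Nv Nw).
by rewrite EE [X in _ <= _ + X]distrC; exact: ler_distD.
Unshelve. all: by end_near. Qed.

Section Hessian.
Variables (R : realType) (n : nat) (U : set 'cV[R]_n) (H : 'cV[R]_n -> R).
Hypotheses (U_open : open U) (H_smooth : smooth_on U H).

Lemma smooth_on_gradient : smooth_on U (gradient H).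
Proof.
by apply: (smooth_on_gradient_comp U_open (f := id)) H_smooth => // k;
  exact: Ck_on_id.
Qed.

Lemma pairing_gradient x b : U x -> pairing (gradient H x) b = 'd H x b.
Proof.
move=> Ux; rewrite pairingE diff_coord_sum; apply: eq_bigr => i _.
rewrite mxE deriveE 1?mulrC //; exact: smooth_on_differentiable Ux.
Qed.

(** Pairing the Hessian with two vectors is the second differential of H, since
    pairing the gradient with a vector is the first. *)
Lemma hessian_sym x a b : U x ->
  pairing ('d (gradient H) x a) b = pairing ('d (gradient H) x b) a.
Proof.
move=> Ux.
have pairing_diff c d : pairing ('d (gradient H) x c) d =
    'd (fun y => 'd H y d) x c.
  have d_lin : linear (fun e : 'cV[R]_n => pairing e d).
    by move=> t e e'; rewrite !pairingE scaler_sumr -big_split /=;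
      apply: eq_bigr => i _; rewrite !mxE mulrDl -mulrA.
  pose dL : {linear 'cV[R]_n -> R} :=
    HB.pack (fun e : 'cV[R]_n => pairing e d)
            (GRing.isLinear.Build _ _ _ _ _ d_lin).
  have dG := smooth_on_differentiable smooth_on_gradient Ux.
  have [dpG EpG] := diff_linear_cV dL dG.
  rewrite -[LHS]EpG /=.
  suff [_ ->] : differentiable (fun y => 'd H y d) x /\
      'd (fun y => 'd H y d) x =
      'd (fun y => pairing (gradient H y) d) x :> (_ -> _) by [].
  apply: near_eq_diff dpG; near=> y; apply: pairing_gradient.
  by near: y; exact: open_nbhs_nbhs.
by rewrite !pairing_diff; apply: diff2_sym Ux.
Unshelve. all: by end_near. Qed.

End Hessian.

(** * Lagrangian subspaces and Dirac structures *)

Section ConstrainedGraph.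
Variables (R : realType) (s n : nat) (S : {linear 'cV[R]_n -> 'cV[R]_n}).
Let V := ('cV[R]_(s + n) * 'cV[R]_(s + n))%type.

(** The subspace {f' = 0, e = S f} of pairs ((f', f), (e', e)) is presented as
    a kernel, so that membership is a pair of equations.  Its s = 0 instance
    is the graph of S; the instance with S a Hessian is a tangent space of the
    energy relation. *)
Definition constrained_graph_eqn (p : V) : 'cV[R]_s * 'cV[R]_n :=
  (usubmx p.1, dsubmx p.2 - S (dsubmx p.1)).

Fact constrained_graph_eqn_linear : linear constrained_graph_eqn.
Proof.
move=> a p q; rewrite /constrained_graph_eqn !linearP /=.
by congr pair; rewrite /= scalerDr addrACA.
Qed.

HB.instance Definition _ := GRing.isLinear.Build _ _ _ _
  constrained_graph_eqn constrained_graph_eqn_linear.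

Definition constrained_graph : {vspace V} :=
  lker (linfun constrained_graph_eqn).

Lemma mem_constrained_graph p : p \in constrained_graph <->
  usubmx p.1 = 0 /\ dsubmx p.2 = S (dsubmx p.1).
Proof.
rewrite memv_ker lfunE /=; split=> [/eqP[-> /eqP]|[u0 dS]].
  by rewrite subr_eq0 => /eqP.
by rewrite /constrained_graph_eqn u0 dS subrr.
Qed.

(** Symmetry of S gives isotropy.  For co-isotropy, testing against the vectors
    (0, (e', 0)) forces f' = 0, and testing against ((0, f), (0, S f)) forces
    the remaining equation. *)
Lemma constrained_graph_lagrangian :
  (forall a b, pairing (S a) b = pairing (S b) a) ->
  lagrangian_subspace constrained_graph.
Proof.
move=> Ssym.
have can_formE (p q : V) : can_form p q =
    (pairing (usubmx p.2) (usubmx q.1) + pairing (dsubmx p.2) (dsubmx q.1)) -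
    (pairing (usubmx q.2) (usubmx p.1) + pairing (dsubmx q.2) (dsubmx p.1)).
  by rewrite /can_form -!pairing_col_mx !vsubmxK.
split=> [p /mem_constrained_graph[p1 p2] q /mem_constrained_graph[q1 q2]|p po].
  by rewrite can_formE p1 q1 p2 q2 !pairing0r Ssym subrr.
apply/mem_constrained_graph; split.
  apply: pairing_nondeg => e.
  have : (0, col_mx e 0) \in constrained_graph.
    by apply/mem_constrained_graph; rewrite /= col_mxKd !linear0.
  move=> /po; rewrite can_formE /= col_mxKu col_mxKd !linear0 !pairing0r
    pairing0l.
  by rewrite !addr0 sub0r => /eqP; rewrite oppr_eq0 pairingC => /eqP.
apply/eqP; rewrite -subr_eq0; apply/eqP/pairing_nondeg => f.
have : (col_mx 0 f, col_mx 0 (S f)) \in constrained_graph.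
  by apply/mem_constrained_graph; rewrite /= col_mxKu !col_mxKd.
move=> /po; rewrite can_formE /= !col_mxKu !col_mxKd !pairing0r !pairing0l
  !add0r.
by rewrite pairingDl pairingNl Ssym.
Qed.

End ConstrainedGraph.

Section DissipativeDirac.
Variables (R : realType) (s n1 n2 n3 m : nat) (J : 'M[R]_(n1 + n2 + n3 + m)).
Hypothesis J_skew : J + J^T = 0.
Let N := (n1 + n2 + n3 + m)%N.
Let X := 'cV[R]_(s + (n1 + n2) + N + m).

Definition state_port (v : X) : 'cV[R]_(s + (n1 + n2)) := usubmx (usubmx v).
Definition resistive_port (v : X) : 'cV[R]_N := dsubmx (usubmx v).
Definition external_port (v : X) : 'cV[R]_m := dsubmx v.

(** The vector w = (z1', dH/dz2, z3, u); its third block is read off from the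
    resistive flow. *)
Definition system_input (p : X * X) : 'cV[R]_N :=
  col_mx (col_mx (col_mx (usubmx (dsubmx (state_port p.1)))
                         (dsubmx (dsubmx (state_port p.2))))
                 (dsubmx (usubmx (resistive_port p.1))))
         (external_port p.2).

(** The vector (dH/dz1, z2', 0, - y). *)
Definition system_output (p : X * X) : 'cV[R]_N :=
  col_mx (col_mx (col_mx (usubmx (dsubmx (state_port p.2)))
                         (dsubmx (dsubmx (state_port p.1))))
                 0)
         (external_port p.1).

Definition dissipative_dirac_eqn (p : X * X) : 'cV[R]_s * 'cV[R]_N * 'cV[R]_N :=
  (usubmx (state_port p.2), resistive_port p.1 - system_input p,
   system_output p - J *m system_input p + resistive_port p.2).

Fact dissipative_dirac_eqn_linear : linear dissipative_dirac_eqn.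
Proof.
have in_lin a p q :
    system_input (a *: p + q) = a *: system_input p + system_input q.
  rewrite /system_input /state_port /resistive_port /external_port.
  by rewrite !linearP /= !scale_col_mx !add_col_mx.
have out_lin a p q :
    system_output (a *: p + q) = a *: system_output p + system_output q.
  by rewrite /system_output /state_port /external_port !linearP /=
             !scale_col_mx !add_col_mx scaler0 addr0.
move=> a p q; rewrite /dissipative_dirac_eqn in_lin out_lin.
rewrite /state_port /resistive_port !linearP /= /state_port /resistive_port.
congr (_, _, _) => /=.
  by rewrite scalerDr addrACA.
by rewrite !scalerDr [X in X + _ = _]addrACA [LHS]addrACA.
Qed.

HB.instance Definition _ := GRing.isLinear.Build _ _ _ _
  dissipative_dirac_eqn dissipative_dirac_eqn_linear.

Definition dissipative_dirac : {vspace X * X} :=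
  lker (linfun dissipative_dirac_eqn).

Lemma mem_dissipative_dirac p : p \in dissipative_dirac <->
  [/\ usubmx (state_port p.2) = 0, resistive_port p.1 = system_input p
    & system_output p = J *m system_input p - resistive_port p.2].
Proof.
rewrite memv_ker lfunE /=; split=> [/eqP[-> /eqP + /eqP]|[u0 r1 r2]].
  by rewrite subr_eq0 addr_eq0 subr_eq => /eqP-> /eqP->; rewrite addrC.
by rewrite /dissipative_dirac_eqn u0 r1 [X in (_, _, X)]addrAC r2 subrK !subrr.
Qed.

(** In the first and second state blocks input and output exchange flow and
    effort, which the symmetric pairing does not see; the zero block of the
    output cancels the contribution of the third block of the input. *)
Lemma sym_form_ports (p q : X * X) : sym_form p q =
  pairing (usubmx (state_port p.2)) (usubmx (state_port q.1)) +
  pairing (usubmx (state_port q.2)) (usubmx (state_port p.1)) +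
  (pairing (system_output p) (system_input q) +
   pairing (resistive_port p.2) (resistive_port q.1)) +
  (pairing (system_output q) (system_input p) +
   pairing (resistive_port q.2) (resistive_port p.1)).
Proof.
have split_pairing (e f : X) : pairing e f =
    pairing (usubmx (state_port e)) (usubmx (state_port f)) +
    (pairing (usubmx (dsubmx (state_port e))) (usubmx (dsubmx (state_port f))) +
     pairing (dsubmx (dsubmx (state_port e))) (dsubmx (dsubmx (state_port f)))) +
    pairing (resistive_port e) (resistive_port f) +
    pairing (external_port e) (external_port f).
  by rewrite -!pairing_col_mx !vsubmxK.
rewrite /sym_form !split_pairing !pairing_col_mx !pairing0l.
rewrite (pairingC (dsubmx (dsubmx (state_port p.1)))).
rewrite (pairingC (dsubmx (dsubmx (state_port q.1)))).
rewrite (pairingC (external_port p.1)) (pairingC (external_port q.1)).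
by ring.
Qed.

Lemma pairing_skew v w : pairing (J *m v) w = - pairing (J *m w) v.
Proof.
have -> : pairing (J *m v) w = pairing (J^T *m w) v by rewrite pairing_mulmx.
have -> : J^T = - J by apply/eqP; rewrite -addr_eq0 addrC J_skew.
by rewrite mulNmx pairingNl.
Qed.

(** A solution is determined by f', the input w and the resistive effort er,
    subject only to the third block of J w - er being zero.  For co-isotropy
    the candidate p is tested on w = 0, which gives f_r = w (the third blocks
    agree by construction), then on f' alone, which gives e' = 0, and then on
    er = J w with w arbitrary, which gives the remaining equation. *)
Lemma dissipative_diracP : dirac_structure dissipative_dirac.
Proof.
split=> [p /mem_dissipative_dirac[p1 p2 p3] 
        q /mem_dissipative_dirac[q1 q2 q3]|p po].
  rewrite sym_form_ports p1 q1 p2 q2 p3 q3 !pairing0l !pairingDl !pairingNl.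
  by rewrite (pairing_skew (system_input p)); ring.
(* the solution with free parameters f', w and er *)
pose test (f' : 'cV[R]_s) (w er : 'cV[R]_N) : X * X :=
  (col_mx (col_mx (col_mx f' (col_mx (usubmx (usubmx (usubmx w)))
     (dsubmx (usubmx (usubmx (J *m w - er)))))) w) (dsubmx (J *m w - er)),
   col_mx (col_mx (col_mx 0 (col_mx (usubmx (usubmx (usubmx (J *m w - er))))
     (dsubmx (usubmx (usubmx w))))) er) (dsubmx w)).
have test_state f' w er : usubmx (state_port (test f' w er).1) = f'.
  by rewrite /state_port /= !col_mxKu.
have test_res1 f' w er : resistive_port (test f' w er).1 = w.
  by rewrite /resistive_port /= col_mxKu col_mxKd.
have test_res2 f' w er : resistive_port (test f' w er).2 = er.
  by rewrite /resistive_port /= col_mxKu col_mxKd.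
have test_in f' w er : system_input (test f' w er) = w.
  rewrite /system_input test_res1 /state_port /external_port /=.
  by rewrite !(col_mxKu, col_mxKd) !vsubmxK.
have test_out f' w er : dsubmx (usubmx (J *m w - er)) = 0 ->
    system_output (test f' w er) = J *m w - er.
  move=> E; rewrite /system_output -E /state_port /external_port /=.
  by rewrite !(col_mxKu, col_mxKd) !vsubmxK.
have test_mem f' w er : dsubmx (usubmx (J *m w - er)) = 0 ->
    test f' w er \in dissipative_dirac.
  move=> E; apply/mem_dissipative_dirac.
  rewrite test_res1 test_res2 test_in test_out // /state_port /=.
  by rewrite !col_mxKu.
have po' f' w er : dsubmx (usubmx (J *m w - er)) = 0 ->
    pairing (usubmx (state_port p.2)) f' +
    (pairing (system_output p) w + pairing (resistive_port p.2) w) +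
    (pairing (J *m w - er) (system_input p) +
     pairing er (resistive_port p.1)) = 0.
  move=> E; have := po _ (test_mem f' w er E).
  rewrite sym_form_ports test_state test_res1 test_res2 test_in test_out //.
  by rewrite {2}/state_port /= !col_mxKu pairing0l addr0.
have res1 : resistive_port p.1 = system_input p.
  apply/eqP; rewrite -subr_eq0; apply/eqP.
  set d := _ - _.
  have d3 : dsubmx (usubmx d) = 0.
    by rewrite /d /system_input linearB linearB /= col_mxKu col_mxKd subrr.
  apply: pairing_nondeg => f.
  (* the admissible resistive efforts for w = 0 have zero third block *)
  pose f0 : 'cV[R]_N := col_mx (col_mx (usubmx (usubmx f)) 0) (dsubmx f).
  have -> : pairing d f = pairing f0 d.
    rewrite pairingC -[f]vsubmxK -[usubmx f]vsubmxK -[d]vsubmxK.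
    by rewrite -[usubmx d]vsubmxK d3 !pairing_col_mx !pairing0r.
  have E : dsubmx (usubmx (J *m 0 - f0)) = 0.
    by rewrite mulmx0 sub0r !linearN /= col_mxKu col_mxKd oppr0.
  have := po' 0 0 f0 E; rewrite mulmx0 !pairing0r sub0r pairingNl => po0.
  by rewrite pairingC /d pairingDl pairingNl -(pairingC f0) -(pairingC f0); lra.
apply/mem_dissipative_dirac; split=> //.
  apply: pairing_nondeg => f.
  have := po' f 0 0.
  rewrite mulmx0 subrr !linear0 !pairing0r !pairing0l => /(_ erefl).
  by rewrite !addr0.
apply/eqP; rewrite -subr_eq0; apply/eqP/pairing_nondeg => w.
have := po' 0 w (J *m w);
  rewrite subrr !linear0 pairing0r pairing0l => /(_ erefl).
rewrite res1 (pairing_skew w) opprB !pairingDl !pairingNl; lra.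
Qed.

End DissipativeDirac.

(** * The energy relation as a Lagrangian submanifold *)

Section ConstrainedEnergy.
Variables (R : realType) (s n : nat) (U : set 'cV[R]_n) (H : 'cV[R]_n -> R).
Hypotheses (U_open : open U) (H_smooth : smooth_on U H).
Let V := ('cV[R]_(s + n) * 'cV[R]_(s + n))%type.

Definition cylinder : set 'cV[R]_(s + n) := [set x | U (dsubmx x)].

(** The first s coordinates are constrained to vanish, and their efforts are
    free, as for a conormal bundle. *)
Definition constrained_energy : set V :=
  [set p | [/\ cylinder p.1, usubmx p.1 = 0
             & dsubmx p.2 = gradient H (dsubmx p.1)]].

(** Exchanging the first blocks of state and effort collects the free
    coordinates (e', z) in the first component; the second one is then zero
    exactly on the energy relation when c = -1.  The inverse chart is the case
    c = 1. *)
Definition energy_chart (c : R) (p : V) : V :=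
  (col_mx (usubmx p.2) (dsubmx p.1),
   col_mx (usubmx p.1) (dsubmx p.2 + c *: gradient H (dsubmx p.1))).

Lemma energy_chartK c : cancel (energy_chart (- c)) (energy_chart c).
Proof.
move=> [x e]; rewrite /energy_chart /= !(col_mxKu, col_mxKd) scaleNr subrK.
by rewrite !vsubmxK.
Qed.

Lemma cylinder_open : open cylinder.
Proof.
by apply: open_comp => // x _; exact: (@linear_cV_continuous _ _ _ dsubmx).
Qed.

Let W : set V := [set p | cylinder p.1].

Let W_open : open W.
Proof. by apply: open_comp cylinder_open => p _; exact: cvg_fst. Qed.

Lemma smooth_energy_chart c : smooth_on W (energy_chart c).
Proof.
have sfst : smooth_on W fst.
  move=> k; apply: (Ck_on_linear W_open (L := fst)); last exact: Ck_on_id.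
  by move=> ?; exact: cvg_fst.
have ssnd : smooth_on W snd.
  move=> k; apply: (Ck_on_linear W_open (L := snd)); last exact: Ck_on_id.
  by move=> ?; exact: cvg_snd.
have slin m (L : {linear 'cV[R]_(s + n) -> 'cV[R]_m})
    (f : V -> 'cV[R]_(s + n)) :
  smooth_on W f -> smooth_on W (fun p => L (f p)) by exact: smooth_on_linear_cV.
move=> k; apply: Ck_on_pair => //; apply: smooth_on_col_mx => //;
  try exact: slin.
move=> {}k; apply: Ck_on_add => //; first exact: slin.
apply: smooth_on_linear_cV => //; apply: smooth_on_gradient_comp H_smooth => //.
exact: slin.
Qed.

Lemma constrained_energy_submanifold : smooth_submanifold constrained_energy.
Proof.
move=> p [Wp _ _].
have imW : energy_chart (-1) @` W = W.
  apply/seteqP; split=> [_ [q Wq <-]|q Wq];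
    first by rewrite /W /cylinder /= col_mxKd.
  exists (energy_chart 1 q); first by rewrite /W /cylinder /= col_mxKd.
  by have := @energy_chartK (-1); rewrite opprK; apply.
exists (s + n)%N, (s + n)%N, W, (energy_chart (-1)), (energy_chart 1);
  rewrite imW.
split=> //.
- by split; exact: smooth_energy_chart.
- by move=> q _; exact: energy_chartK.
move=> q Wq; rewrite /energy_chart /= scaleN1r; split=> [[_ -> ->]|/eqP].
  by rewrite subrr col_mx0.
by rewrite col_mx_eq0 subr_eq0 => /andP[/eqP ? /eqP ?].
Qed.

(** Velocities of curves satisfy the differentiated equations.  Conversely a
    solution v of these is the velocity of the curve moving along a straight
    line in the free coordinates (e', z), with e_z following grad H. *)
Lemma tangent_constrained_energy p : constrained_energy p ->
  tangent_space constrained_energy p =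
  [set` constrained_graph s ('d (gradient H) (dsubmx p.1))].
Proof.
move=> [Up p1 p2].
have dG : differentiable (gradient H) (dsubmx p.1).
  exact: (smooth_on_differentiable (smooth_on_gradient U_open H_smooth) Up).
apply/seteqP; split=> v.
  move=> [e [c [e0 cs cM c0 <-]]].
  have I0 : - e < 0 < e by rewrite oppr_lt0 e0.
  have dc : differentiable c 0.
    by apply: (smooth_on_differentiable cs); rewrite /= in_itv.
  have near0 : \forall t \near 0, - e < t < e.
    have : open_nbhs 0 `]- e, e[%classic by split=> //=; rewrite in_itv.
    by move=> /open_nbhs_nbhs; apply: filterS => t; rewrite /= in_itv.
  have [dc1 Ec1] := @diff_linear_comp _ _ _ _ fst c 0 (fun _ => cvg_fst) dc.
  have [dc2 Ec2] := @diff_linear_comp _ _ _ _ snd c 0 (fun _ => cvg_snd) dc.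
  rewrite derive1E' //; apply/mem_constrained_graph.
  have [du1 Eu1] := diff_linear_cV usubmx dc1.
  have [dd1 Ed1] := diff_linear_cV dsubmx dc1.
  have [dd2 Ed2] := diff_linear_cV dsubmx dc2.
  have Eu : 'd (fun t => usubmx (c t).1) 0 1 = usubmx ('d c 0 1).1 :=
    etrans (Eu1 1) (congr1 usubmx (Ec1 1)).
  have Ex : 'd (fun t => dsubmx (c t).1) 0 1 = dsubmx ('d c 0 1).1 :=
    etrans (Ed1 1) (congr1 dsubmx (Ec1 1)).
  have Ee : 'd (fun t => dsubmx (c t).2) 0 1 = dsubmx ('d c 0 1).2 :=
    etrans (Ed2 1) (congr1 dsubmx (Ec2 1)).
  split.
    rewrite -Eu; have [_ E] : differentiable (fun t => usubmx (c t).1) 0 /\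
      'd (fun t => usubmx (c t).1) 0 = 'd (cst (0 : 'cV[R]_s)) 0 :> (R -> _).
      apply: near_eq_diff; last exact: differentiable_cst.
      by apply: filterS near0 => t /cM[_ -> _].
    apply: etrans (congr1 (fun h : R -> _ => h 1) E) _.
    exact: (congr1 (fun h : R -> _ => h 1) (diff_cst _ _)).
  have dG' : differentiable (gradient H) (dsubmx (c 0).1) by rewrite c0.
  rewrite -Ee -Ex -c0.
  have [_ E] : differentiable (fun t => dsubmx (c t).2) 0 /\
      'd (fun t => dsubmx (c t).2) 0 =
      'd (gradient H \o (fun t => dsubmx (c t).1)) 0 :> (R -> _).
    apply: near_eq_diff; last exact: differentiable_comp.
    by apply: filterS near0 => t /cM[_ _ ->].
  apply: etrans (congr1 (fun h : R -> _ => h 1) E) _.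
  exact: (congr1 (fun h : R -> _ => h 1) (diff_comp dd1 dG')).
move=> /mem_constrained_graph[v1 v2].
pose x t := dsubmx p.1 + t *: dsubmx v.1.
have x0 : x 0 = dsubmx p.1 by rewrite /x scale0r addr0.
have [dx Ex] := diff_affine (dsubmx p.1) (dsubmx v.1) 0.
have [e e0 eU] : exists2 e : R, 0 < e & forall t, - e < t < e -> U (x t).
  have : nbhs (x 0) U by rewrite x0; exact: open_nbhs_nbhs.
  move=> /(differentiable_continuous dx) /nbhs_normP[e e0 eU];
    exists e => // t te.
  by apply: eU; rewrite /= sub0r normrN ltr_norml.
exists e, (fun t => (p.1 + t *: v.1,
  col_mx (usubmx p.2 + t *: usubmx v.2) (gradient H (x t)))).
have xd t : dsubmx (p.1 + t *: v.1) = x t by rewrite linearD linearZ.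
split=> //.
- move=> k; apply: Ck_on_pair; [exact: interval_open|exact: smooth_on_affine|].
  apply: smooth_on_col_mx; [exact: interval_open|exact: smooth_on_affine|].
  apply: smooth_on_gradient_comp H_smooth;
    [exact: interval_open| |exact: smooth_on_affine].
  by move=> t; rewrite /= in_itv => /eU.
- move=> t te; split=> /=; first by rewrite /cylinder /= xd; exact: eU.
    by rewrite linearD linearZ /= p1 v1 scaler0 addr0.
  by rewrite col_mxKd xd.
- by rewrite x0 !scale0r !addr0 -p2 vsubmxK -surjective_pairing.
have [d1 E1] := diff_affine p.1 v.1 0.
have [du2 Eu2] := diff_affine (usubmx p.2) (usubmx v.2) 0.
have dG' : differentiable (gradient H) (x 0) by rewrite x0.
have dGx := differentiable_comp dx dG'.
have [d2 E2] := diff_col_mx du2 dGx.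
rewrite derive1E'; last exact: differentiable_pair.
have Egx : 'd (gradient H \o x) 0 1 = dsubmx v.2.
  apply: etrans (congr1 (fun h : R -> _ => h 1) (diff_comp dx dG')) _.
  have v2x : dsubmx v.2 = 'd (gradient H) (x 0) (dsubmx v.1) by rewrite x0.
  apply: etrans _ (esym v2x).
  exact: (congr1 ('d (gradient H) (x 0)) (etrans (Ex 1) (scale1r _))).
have Ev1 := etrans (E1 1) (scale1r v.1).
have Ev2 := etrans (E2 1) (congr2 col_mx (etrans (Eu2 1) (scale1r _)) Egx).
have Epair := congr1 (fun h : R -> V => h 1) (diff_pair d1 d2).
apply: (etrans Epair).
apply: (etrans (congr2 pair Ev1 Ev2)).
by rewrite vsubmxK; case: (v).
Qed.

Lemma constrained_energy_lagrangian :
  lagrangian_submanifold cylinder constrained_energy.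
Proof.
split=> [p []//||p Lp]; first exact: constrained_energy_submanifold.
exists (constrained_graph s ('d (gradient H) (dsubmx p.1))); split.
  exact: tangent_constrained_energy.
by apply: constrained_graph_lagrangian => a b; apply: hessian_sym => //;
  case: Lp.
Qed.

End ConstrainedEnergy.

(** * The port-Hamiltonian representation *)

Lemma dsubmx_0row (R : Type) n (v : 'M[R]_(0 + n, 1)) :
  dsubmx v = v :> 'M[R]_(n, 1).
Proof. by apply/matrixP => i j; rewrite mxE; congr (v _ _); exact: val_inj. Qed.

Section Representation.
Variables (R : realType) (n1 n2 n3 m : nat).
Variables (U : set 'cV[R]_(n1 + n2)) (H : 'cV[R]_(n1 + n2) -> R).
Variables (J Rd : 'M[R]_(n1 + n2 + n3 + m)).
Hypotheses (U_open : open U) (H_smooth : smooth_on U H).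
Hypotheses (J_skew : J + J^T = 0) (Rd_sym : Rd = Rd^T).
Hypothesis Rd_ge0 : forall v : 'cV[R]_(n1 + n2 + n3 + m),
  0 <= (v^T *m Rd *m v) 0 0.
Let N := (n1 + n2 + n3 + m)%N.

Definition resistive_graph : {vspace 'cV[R]_N * 'cV[R]_N} :=
  constrained_graph 0 (mulmx Rd).

Lemma mem_resistive_graph p : p \in resistive_graph <-> p.2 = Rd *m p.1.
Proof.
have d1 : dsubmx (p.1 : 'M[R]_(0 + N, 1)) = p.1 := dsubmx_0row _.
have d2 : dsubmx (p.2 : 'M[R]_(0 + N, 1)) = p.2 := dsubmx_0row _.
have memE := @mem_constrained_graph R 0 N (mulmx Rd) p.
split=> [Lp|E].
  have [_ E] := iffLR memE Lp.
  exact: etrans (esym d2) (etrans E (congr1 (mulmx Rd) d1)).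
apply: (iffRL memE); split; first by apply/matrixP => -[].
exact: etrans d2 (etrans E (congr1 (mulmx Rd) (esym d1))).
Qed.

Lemma resistive_graph_lagrangian : lagrangian_subspace resistive_graph.
Proof.
apply: (@constrained_graph_lagrangian R 0 N (mulmx Rd)) => a b.
by rewrite /= pairing_mulmx -Rd_sym.
Qed.

Lemma resistive_graph_ge0 : nonneg_subspace resistive_graph.
Proof.
move=> p /mem_resistive_graph ->.
by rewrite /pairing trmx_mul -Rd_sym.
Qed.

(** The case s = 0 has explicit energy and the case s = 1 implicit energy. *)
Definition representation (s : nat) : port_hamiltonian R (s + (n1 + n2)) N m :=
  PortHamiltonian (@cylinder_open R s _ U U_open)
    (dissipative_diracP s J_skew)
    resistive_graph_lagrangian resistive_graph_ge0
    (constrained_energy_lagrangian s U_open H_smooth).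

(** A solution of the system is completed by x' = 0, e' = 0, f_r = w and
    e_r = Rd w.  Conversely the Dirac structure forces f_r = w, so that the
    resistive relation turns J w - e_r into (J - Rd) w. *)
Lemma representation_equivalent s :
  equivalent_to_ph (@system_solution R n1 n2 n3 m U H J Rd) (representation s).
Proof.
(* z3 is the third block of the resistive flow *)
pose tau (i : 'I_n3) : 'I_(s + (n1 + n2) + N + N) :=
  lshift N (rshift (s + (n1 + n2)) (lshift m (rshift (n1 + n2) i))).
exists (@rshift s (n1 + n2)), tau.
split; [exact: rshift_inj| |].
  by move=> i j /lshift_inj/rshift_inj/lshift_inj/rshift_inj.
move=> t0 t1 _ I z1 z2 z3 u y.
have I_open : open I by exact: time_interval_open.
have sigmaE (v : 'cV[R]_(s + (n1 + n2))) :
    rowsub (@rshift s (n1 + n2)) v = dsubmx v.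
  by apply/matrixP => i j; rewrite !mxE.
have tauE (e : 'cV[R]_(s + (n1 + n2))) (f r : 'cV[R]_N) :
    rowsub tau (col_mx (col_mx e f) r) = dsubmx (usubmx f).
  by apply/matrixP => i j; rewrite mxE col_mxEu col_mxEd !mxE.
have diracE (x' e : 'cV[R]_(s + (n1 + n2))) (f r : 'cV[R]_N)
    (y' u' : 'cV[R]_m) :
    (col_mx (col_mx x' f) y', col_mx (col_mx e r) u')
      \in dissipative_dirac s J <->
    [/\ usubmx e = 0,
        f = col_mx (col_mx (col_mx (usubmx (dsubmx x')) (dsubmx (dsubmx e)))
                           (dsubmx (usubmx f))) u'
      & col_mx (col_mx (col_mx (usubmx (dsubmx e)) (dsubmx (dsubmx x'))) 0) y' =
        J *m f - r].
  rewrite mem_dissipative_dirac /system_input /system_output /state_port.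
  rewrite /resistive_port /external_port /= !(col_mxKu, col_mxKd).
  by split=> -[? <-].
split.
- case=> -[sz1 sz2 sz3] [su sy] sol.
  pose z t := col_mx (z1 t) (z2 t).
  have sz : smooth_on I z by exact: smooth_on_col_mx.
  have sG : smooth_on I (fun t => gradient H (z t)).
    by apply: smooth_on_gradient_comp sz H_smooth => // t /sol[].
  pose w t : 'cV[R]_N := col_mx (col_mx (col_mx (derive1 z1 t)
    (dsubmx (gradient H (z t)))) (z3 t)) (u t).
  have sw : smooth_on I w.
    do 3?apply: smooth_on_col_mx => //; first exact: smooth_on_derive1.
    exact: smooth_on_linear_cV.
  pose x t : 'cV[R]_(s + (n1 + n2)) := col_mx 0 (z t).
  have s0 : smooth_on I (fun=> 0 : 'cV[R]_s) by move=> k; exact: Ck_on_cst.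
  have sx : smooth_on I x by exact: smooth_on_col_mx.
  exists x, (fun t => col_mx 0 (gradient H (z t))), w, (fun t => Rd *m w t).
  split=> [t It|]; first by rewrite sigmaE tauE /x /w !(col_mxKu, col_mxKd).
  split=> //.
  + by split=> //; exact: smooth_on_col_mx.
  + by split=> //; exact: smooth_on_linear_cV.
  move=> t It; have [Uz sys] := sol t It; split.
  + by rewrite /= /cylinder /= col_mxKd.
  + have x'E : dsubmx (derive1 x t) = derive1 z t.
      by apply/esym/(derive1_linear_cV I_open (L := dsubmx) _ sx It) => r _;
        exact: esym (col_mxKd _ _).
    have z1E : usubmx (derive1 z t) = derive1 z1 t.
      by apply/esym/(derive1_linear_cV I_open (L := usubmx) _ sz It) => r _;
        exact: esym (col_mxKu _ _).
    have z2E : dsubmx (derive1 z t) = derive1 z2 t.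
      by apply/esym/(derive1_linear_cV I_open (L := dsubmx) _ sz It) => r _;
        exact: esym (col_mxKd _ _).
    apply/diracE; rewrite x'E z1E z2E col_mxKu !col_mxKd; split=> //.
      by rewrite /w col_mxKu col_mxKd.
    by rewrite sys mulmxBl.
  + exact/mem_resistive_graph.
  + by split; rewrite /= ?/cylinder /= ?col_mxKu ?col_mxKd.
case=> [x [e [fr [er [glue [[sx se] [sfr ser] [su sy] sol]]]]]].
have zE t : I t -> col_mx (z1 t) (z2 t) = dsubmx (x t).
  by move=> /glue[-> _]; exact: sigmaE.
have z1E t : I t -> z1 t = usubmx (dsubmx (x t)).
  by move=> /zE <-; rewrite col_mxKu.
have z2E t : I t -> z2 t = dsubmx (dsubmx (x t)).
  by move=> /zE <-; rewrite col_mxKd.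
have z3E t : I t -> z3 t = dsubmx (usubmx (fr t)).
  by move=> /glue[_ ->]; exact: tauE.
have sdx : smooth_on I (fun t => dsubmx (x t)) by exact: smooth_on_linear_cV.
have z1'E t : I t -> derive1 z1 t = usubmx (dsubmx (derive1 x t)).
  by move=> It; rewrite (derive1_linear_cV I_open z1E sdx It)
    (derive1_linear_cV I_open (fun r _ => erefl) sx It).
have z2'E t : I t -> derive1 z2 t = dsubmx (dsubmx (derive1 x t)).
  by move=> It; rewrite (derive1_linear_cV I_open z2E sdx It)
    (derive1_linear_cV I_open (fun r _ => erefl) sx It).
split=> //.
  split.
  - by apply: (smooth_on_eq I_open (fun r Ir => esym (z1E r Ir)));
    exact: smooth_on_linear_cV.
  - by apply: (smooth_on_eq I_open (fun r Ir => esym (z2E r Ir)));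
    exact: smooth_on_linear_cV.
  - apply: (smooth_on_eq I_open (fun r Ir => esym (z3E r Ir))).
    by do 2!apply: smooth_on_linear_cV => //.
move=> t It z dH1 dH2;
  have [Ux /diracE[_ frE out] /mem_resistive_graph /= res [_ _ eE]] := sol t It.
rewrite /dH1 /dH2 /z zE //; split=> //.
rewrite /= in eE; rewrite -eE z1'E // z2'E // z3E // -frE out res.
by rewrite mulmxBl.
Qed.

Lemma representation_explicit : explicit_energy (representation 0).
Proof.
exists H; have EU : cylinder (s := 0) U = U.
  by apply/funext => x; rewrite /cylinder /= dsubmx_0row.
split; first by rewrite /= EU.
apply/seteqP; split=> -[x e] /=.
  by move=> [Ux _ /=]; rewrite !dsubmx_0row.
by move=> [Ux E]; split=> //=; [apply/matrixP => -[]|rewrite !dsubmx_0row].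
Qed.

(** The state (1, z) lies in the domain but under no point of the energy
    relation, whereas a gradient graph has a point above each state. *)
Lemma representation_implicit : U !=set0 -> implicit_energy (representation 1).
Proof.
move=> [z Uz] [K [_ E]].
pose x : 'cV[R]_(1 + (n1 + n2)) := col_mx 1%:M z.
have : ph_energy (representation 1) (x, gradient K x).
  by rewrite E /=; split=> //; rewrite /cylinder /= col_mxKd.
case=> _ /= + _; rewrite col_mxKu => /matrixP/(_ 0 0)/eqP.
by rewrite !mxE oner_eq0.
Qed.

End Representation.

Theorem proposition6p1 (R : realType) (n1 n2 n3 m : nat)
    (U : set 'cV[R]_(n1 + n2)) (H : 'cV[R]_(n1 + n2) -> R)
    (J Rd : 'M[R]_(n1 + n2 + n3 + m))
    (U_open : open U) (U_nonempty : U !=set0) (H_smooth : smooth_on U H)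
    (J_skew : J + J^T = 0) (Rd_sym : Rd = Rd^T)
    (Rd_ge0 : forall v : 'cV[R]_(n1 + n2 + n3 + m),
       0 <= (v^T *m Rd *m v) 0 0) :
  (exists (k r : nat) (S : port_hamiltonian R k r m),
     equivalent_to_ph (@system_solution R n1 n2 n3 m U H J Rd) S /\
     explicit_energy S) /\
  (exists (k r : nat) (S : port_hamiltonian R k r m),
     equivalent_to_ph (@system_solution R n1 n2 n3 m U H J Rd) S /\
     implicit_energy S).
Proof.
split; [exists (0 + (n1 + n2))%N | exists (1 + (n1 + n2))%N];
  exists (n1 + n2 + n3 + m)%N.
  exists (representation U_open H_smooth J_skew Rd_sym Rd_ge0 0); split.
    exact: representation_equivalent.
  exact: representation_explicit.
exists (representation U_open H_smooth J_skew Rd_sym Rd_ge0 1); split.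
  exact: representation_equivalent.
exact: representation_implicit.
Qed.
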